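(* Let $\Sigma^2 \subseteq \mathbb{R}^3$ be a properly immersed translater such that $\partial\,\mathrm{Conv}(\pi(\Sigma)) \neq \emptyset$. Then for every $q \in \partial\,\mathrm{Conv}(\pi(\Sigma))$ and for every $\varrho > 0$ we have $$\sup_{\Sigma \,\cap\, \pi^{-1}(B_\varrho(q))} x_3 = +\infty.$$
   Context: A translater (translating soliton of the mean curvature flow) is a smooth surface $\Sigma^2$ immersed in $\mathbb{R}^3$ (without boundary) satisfying $H = -\langle \nu, e_3\rangle$, where $\nu$ is a smooth unit normal vector field on $\Sigma$ and $H$ is the mean curvature (the sum of the principal curvatures), with sign convention such that the mean curvature vector is $-H\nu$; equivalently, the mean curvature vector equals $e_3^{\perp}$, the normal component of $e_3$. Notation: $\pi\colon\mathbb{R}^3\to\mathbb{R}^2$ is the projection $\pi(x_1,x_2,x_3) = (x_1,x_2)$; $\mathrm{Conv}(\cdot)$ denotes the closed convex hull; $\partial$ denotes the topological boundary in $\mathbb{R}^2$; $B_\varrho(q)$ is the open ball in $\mathbb{R}^2$ centered at $q$ with radius $\varrho$. *)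

(* Defs.v *)
From mathcomp Require Export all_boot all_order all_algebra.
From mathcomp Require Export all_classical all_reals all_analysis.
Export numFieldNormedType.Exports.
Set Implicit Arguments.
Unset Strict Implicit.
Unset Printing Implicit Defensive.
Import Order.TTheory GRing.Theory Num.Theory.
Local Open Scope classical_set_scope.
Local Open Scope ring_scope.

Section Euclidean.
Variable R : realType.

Definition dot n (u v : 'rV[R]_n) : R := (u *m v^T) 0 0.

(* The library norm on 'rV[R]_n is the sup norm, hence a separate Euclidean
   norm and ball; the two norms induce the same topology. *)
Definition enorm n (u : 'rV[R]_n) : R := Num.sqrt (dot u u).

Definition eball n (q : 'rV[R]_n) (r : R) : set 'rV[R]_n :=
  [set y | enorm (y - q) < r].

Definition e3 : 'rV[R]_3 := delta_mx 0 ord_max.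

Definition x3 (p : 'rV[R]_3) : R := p 0 ord_max.

Definition hproj (p : 'rV[R]_3) : 'rV[R]_2 :=
  \row_(j < 2) p 0 (widen_ord (leqnSn 2) j).

Definition closed_convex_hull n (A : set 'rV[R]_n) : set 'rV[R]_n :=
  smallest [set C : set 'rV[R]_n | closed C /\ @convex_set R 'rV[R]_n C] A.

Definition boundary (T : topologicalType) (A : set T) : set T :=
  closure A `\` A°.

End Euclidean.

Section Smooth.
Variable R : realType.

(* C^k on an open set U: C^(k+1) means differentiable on U with all directional
   derivatives of class C^k on U.  For U open this does not depend on the values
   of f outside U. *)
Fixpoint Ck_on m n (k : nat) (U : set 'rV[R]_m) (f : 'rV[R]_m -> 'rV[R]_n) :
    Prop :=
  if k is k'.+1 then
    (forall x, U x -> differentiable f x) /\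
    (forall v : 'rV[R]_m, Ck_on k' U ('D_v f))
  else forall x, U x -> {for x, continuous f}.

Definition smooth_on m n (U : set 'rV[R]_m) (f : 'rV[R]_m -> 'rV[R]_n) : Prop :=
  forall k, Ck_on k U f.

End Smooth.

(* chart_inv is only meaningful on the open set chart_map @` chart_dom. *)
Record chart (R : realType) (M : topologicalType) := Chart {
  chart_dom : set M ;
  chart_map :> M -> 'rV[R]_2 ;
  chart_inv : 'rV[R]_2 -> M ;
  chart_dom_open : open chart_dom ;
  chart_img_open : open (chart_map @` chart_dom) ;
  chart_mapK : forall p, chart_dom p -> chart_inv (chart_map p) = p ;
  chart_map_cont : {within chart_dom, continuous chart_map} ;
  chart_inv_cont : {within chart_map @` chart_dom, continuous chart_inv}
}.

(* Smooth 2-manifolds without boundary, not assumed connected or orientable.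
   The atlas need not be maximal. *)
Record smooth_surface (R : realType) := SmoothSurface {
  surface_carrier :> topologicalType ;
  atlas : set (chart R surface_carrier) ;
  surface_hausdorff : hausdorff_space surface_carrier ;
  surface_second_countable : @second_countable surface_carrier ;
  atlas_cover : forall p, exists2 c, atlas c & chart_dom c p ;
  atlas_compat : forall c d, atlas c -> atlas d ->
    smooth_on (c @` (chart_dom c `&` chart_dom d)) (d \o chart_inv c)
}.

Section Translaters.
Variables (R : realType) (S : smooth_surface R).
Implicit Types (F nu : S -> 'rV[R]_3) (V : set S).

Definition smooth_map_on n V (f : S -> 'rV[R]_n) : Prop :=
  forall c, atlas c -> smooth_on (c @` (chart_dom c `&` V)) (f \o chart_inv c).

Definition immersion F : Prop :=
  smooth_map_on setT F /\
  forall c p, atlas c -> chart_dom c p ->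
    row_free ('J (F \o chart_inv c) (c p)).

Definition properly_immersed F : Prop :=
  immersion F /\ forall K : set 'rV[R]_3, compact K -> compact (F @^-1` K).

(* With row vectors, row i of 'J X x is the i-th partial derivative of X, so
   nu(p) is normal when it is orthogonal to the rows of the Jacobian. *)
Definition unit_normal_on V F nu : Prop :=
  [/\ smooth_map_on V nu,
      (forall p, V p -> enorm (nu p) = 1) &
      forall c p, atlas c -> chart_dom c p -> V p ->
        nu p *m ('J (F \o chart_inv c) (c p))^T = 0].

Definition first_form (X : 'rV[R]_2 -> 'rV[R]_3) (x : 'rV[R]_2) : 'M[R]_2 :=
  'J X x *m ('J X x)^T.

(* h_ij = - <d_i d_j X, N> = <d_i N, d_j X>; this sign makes round spheres with
   outward normal positively curved, so the mean curvature vector is -H N. *)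
Definition second_form (X N : 'rV[R]_2 -> 'rV[R]_3) (x : 'rV[R]_2) : 'M[R]_2 :=
  \matrix_(i, j)
    - dot ('D_(delta_mx 0 i) ('D_(delta_mx 0 j) X) x) (N x).

(* The principal curvatures are the eigenvalues of the shape operator. *)
Definition shape_operator X N (x : 'rV[R]_2) : 'M[R]_2 :=
  second_form X N x *m invmx (first_form X x).

Definition mean_curvature X N (x : 'rV[R]_2) : R := \tr (shape_operator X N x).

(* The equation H = - <nu, e3> is invariant under nu |-> - nu, so it is imposed
   on local unit normal fields; this is the equation (mean curvature vector) =
   (normal part of e3), which makes sense without orientability. *)
Definition translater F : Prop :=
  immersion F /\
  forall p : S, exists (V : set S) (nu : S -> 'rV[R]_3),
    [/\ open V, V p, unit_normal_on V F nu &
        forall c y, atlas c -> chart_dom c y -> V y ->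
          mean_curvature (F \o chart_inv c) (nu \o chart_inv c) (c y) =
          - dot (nu y) (e3 R)].

End Translaters.

(* Main.v *)
Require Import Defs.
From mathcomp Require Import ring lra.
Import Order.TTheory GRing.Theory Num.Theory.
Local Open Scope classical_set_scope.
Local Open Scope ring_scope.
Set Implicit Arguments.
Unset Strict Implicit.
Unset Printing Implicit Defensive.

(* On a translater, Delta u + <grad x3, grad u> equals tr_T D^2 u + <D u, e3>,
   where T is the tangent plane.  If x3 <= M on the part of the surface above a
   disc around q, pick a supporting line of the hull touching it at a point q'
   near q, with orthonormal horizontal coordinates x1 (outward normal, x1 <= 0)
   and x2 centred at q', and put
     u = x1 - eps (ln (1 + k x2^2) + B exp (- (x3 - M) / 2) + eta (x3 - M)).
   Since u tends to -oo at infinity in {-delta <= x1 <= 0}, properness gives a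
   global maximum of u on the surface as soon as some point has x1 > -delta.
   There the tangent plane is orthogonal to D u, and the operator is positive:
   for |x2| >= r by concavity of the logarithm, and for |x2| < r because
   x3 <= M makes the drift of the exponential dominate.  Hence x1 <= -delta on
   the whole surface, so on its hull, which contradicts q' being in the hull. *)

(** * Algebra of the Euclidean inner product *)

Section Dot.
Variables (R : realType) (n : nat).
Implicit Types u v w : 'rV[R]_n.

Lemma dotE u v : dot u v = \sum_i u 0 i * v 0 i.
Proof. by rewrite /dot mxE; apply: eq_bigr => i _; rewrite mxE. Qed.

Lemma dotC u v : dot u v = dot v u.
Proof. by rewrite !dotE; apply: eq_bigr => i _; rewrite mulrC. Qed.

Lemma dotDl u v w : dot (u + v) w = dot u w + dot v w.
Proof. by rewrite /dot mulmxDl mxE. Qed.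

Lemma dotNl u w : dot (- u) w = - dot u w.
Proof. by rewrite /dot mulNmx mxE. Qed.

Lemma dotBl u v w : dot (u - v) w = dot u w - dot v w.
Proof. by rewrite dotDl dotNl. Qed.

Lemma dotZl a u w : dot (a *: u) w = a * dot u w.
Proof. by rewrite /dot -scalemxAl mxE. Qed.

Lemma dotDr u v w : dot w (u + v) = dot w u + dot w v.
Proof. by rewrite dotC dotDl !(dotC w). Qed.

Lemma dotBr u v w : dot w (u - v) = dot w u - dot w v.
Proof. by rewrite dotC dotBl !(dotC w). Qed.

Lemma dotZr a u w : dot w (a *: u) = a * dot w u.
Proof. by rewrite dotC dotZl dotC. Qed.

Lemma dot_suml I (r : seq I) (P : pred I) (f : I -> 'rV[R]_n) w :
  dot (\sum_(i <- r | P i) f i) w = \sum_(i <- r | P i) dot (f i) w.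
Proof. by rewrite /dot mulmx_suml summxE. Qed.

Lemma dot_ge0 u : 0 <= dot u u.
Proof. by rewrite dotE sumr_ge0// => i _; rewrite -expr2 sqr_ge0. Qed.

Lemma dot_eq0 u : (dot u u == 0) = (u == 0).
Proof.
apply/idP/eqP => [|->]; last by rewrite /dot mul0mx mxE.
rewrite dotE psumr_eq0 => [/allP u0|i _]; last by rewrite -expr2 sqr_ge0.
apply/rowP => i; rewrite mxE; apply/eqP.
by have := u0 i (mem_index_enum i); rewrite mulf_eq0 orbb.
Qed.

Lemma dot_gt0 u : (0 < dot u u) = (u != 0).
Proof. by rewrite lt_def dot_ge0 andbT dot_eq0. Qed.

Lemma enorm_sqr u : enorm u ^+ 2 = dot u u.
Proof. by rewrite sqr_sqrtr// dot_ge0. Qed.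

End Dot.

Lemma dot_e3 (R : realType) (p : 'rV[R]_3) : dot p (e3 R) = x3 p.
Proof.
rewrite dotE (bigD1 ord_max)//= !mxE !eqxx mulr1 big1 ?addr0// => i im.
by rewrite !mxE (negbTE im) mulr0.
Qed.

Lemma dot_e3_e3 (R : realType) : dot (e3 R) (e3 R) = 1.
Proof. by rewrite dot_e3 /x3 mxE. Qed.

Lemma mulmx_trE (R : realType) m n p (A : 'M[R]_(m, n)) (B : 'M[R]_(p, n)) i j :
  (A *m B^T) i j = dot (row i A) (row j B).
Proof. by rewrite dotE !mxE; apply: eq_bigr => k _; rewrite !mxE. Qed.

Lemma lift_ord01 : lift ord0 ord0 = 1 :> 'I_2.
Proof. exact/val_inj. Qed.

Lemma ord2P (P : 'I_2 -> Prop) : P 0 -> P 1 -> forall i, P i.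
Proof.
move=> P0 P1 i; have [->//|i1] : i = 0 \/ i = 1; last by rewrite i1.
by case: i => [[|[|//]]] ?; [left|right]; exact/val_inj.
Qed.

(** * Orthonormal frames and traces *)

Section Frame.
Variable R : realType.

(** Gram-Schmidt on the rows [r0], [r1] of [J]: the rows of [V *m J] are [r0] and [E r1 - P r0],
    normalised. The squared length of the latter is [W = E (E G - P^2)], and [row_free J] makes both
    lengths nonzero. *)
Lemma exists_orthonormal_frame n (J : 'M[R]_(2, n)) : row_free J ->
  exists V : 'M[R]_2, V *m (J *m J^T) *m V^T = 1%:M.
Proof.
move=> Jfree.
set r0 := row 0 J; set r1 := row 1 J.
pose E := dot r0 r0; pose P := dot r0 r1; pose G := dot r1 r1.
have inj (a b : R) : a *: r0 + b *: r1 = 0 -> a = 0 /\ b = 0.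
  move=> ab0; pose v : 'rV[R]_2 := \row_j (if j == 0 then a else b).
  have : v *m J = 0.
    by rewrite mulmx_sum_row big_ord_recl big_ord1 !mxE /= lift_ord01.
  move/eqP; rewrite -[X in _ == X](mul0mx _ J) => /eqP /(row_free_inj Jfree).
  move=> /rowP v0; split; first by have := v0 0; rewrite !mxE.
  by have := v0 1; rewrite !mxE.
have E0 : 0 < E.
  rewrite dot_gt0; apply/eqP => r00.
  have [|/eqP] := inj 1 0; first by rewrite r00 scaler0 scale0r addr0.
  by rewrite oner_eq0.
have W0 : 0 < E * (E * G - P ^+ 2).
  have -> : E * (E * G - P ^+ 2) =
      dot (- P *: r0 + E *: r1) (- P *: r0 + E *: r1).
    by rewrite !(dotDl, dotDr, dotZl, dotZr) (dotC r1 r0) -/E -/P -/G; ring.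
  rewrite dot_gt0; apply/eqP => /inj[_ E00].
  by move: E0; rewrite E00 ltxx.
set W := _ * _ in W0.
pose sE := Num.sqrt E; pose sW := Num.sqrt W.
have sE0 : sE != 0 by rewrite gt_eqF// sqrtr_gt0.
have sW0 : sW != 0 by rewrite gt_eqF// sqrtr_gt0.
have sE2 : sE ^+ 2 = E by rewrite sqr_sqrtr// ltW.
have sW2 : sW ^+ 2 = W by rewrite sqr_sqrtr// ltW.
pose V : 'M[R]_2 := \matrix_(i, j)
  if i == 0 then (if j == 0 then sE^-1 else 0)
  else (if j == 0 then - P / sW else E / sW).
exists V; apply/matrixP => i j.
have entry k l : (J *m J^T) k l = dot (row k J) (row l J) by rewrite mulmx_trE.
have sumI2 (f : 'I_2 -> R) : \sum_k f k = f 0 + f 1.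
  by rewrite big_ord_recl big_ord1 lift_ord01.
rewrite !mxE sumI2 ![(V *m _) _ _]mxE !sumI2 !entry -/r0 -/r1 (dotC r1 r0).
rewrite -/E -/P -/G !mxE /=.
elim/ord2P: i; elim/ord2P: j; rewrite /= ?eqxx ?oner_eq0 /=.
- by rewrite -[in X in X = _]sE2; field.
- by field; rewrite sE0 sW0.
- by field; rewrite sE0 sW0.
- have -> : 1 = W / sW ^+ 2 by rewrite sW2 divff// gt_eqF.
  by rewrite /W; field.
Qed.

(** The hypothesis gives [invmx g = V^T *m V], and the trace is cyclic. *)
Lemma mxtrace_frame (g V A : 'M[R]_2) : V *m g *m V^T = 1%:M ->
  \tr (A *m invmx g) = \sum_k (row k V *m A *m (row k V)^T) 0 0.
Proof.
move=> Vg1.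
have [VgU VTU] := mulmx1_unit Vg1.
have VU : V \in unitmx by rewrite -unitmx_tr.
have gU : g \in unitmx by move: VgU; rewrite unitmx_mul => /andP[].
have gV : invmx g = V^T *m V.
  have : g *m (V^T *m V) = 1%:M.
    have -> : g *m (V^T *m V) = invmx V *m (V *m g *m V^T) *m V.
      by rewrite !mulmxA mulVmx// mul1mx.
    by rewrite Vg1 mulmx1 mulVmx.
  by move=> gVV; rewrite -[RHS]mul1mx -(mulVmx gU) -mulmxA gVV mulmx1.
rewrite gV mulmxA mxtrace_mulC mulmxA /mxtrace; apply: eq_bigr => k _.
by rewrite -row_mul [LHS]mulmx_trE.
Qed.

End Frame.

(** * Derivatives along lines and the second derivative test *)

Section Calculus.
Variable R : realType.

Lemma continuous_dotl n (w : 'rV[R]_n) : continuous (fun u => dot u w).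
Proof.
move=> u; rewrite (_ : (fun u => dot u w) = (fun u => \sum_i u 0 i * w 0 i)).
  rewrite /continuous_at; elim: (index_enum _) => [|i r IHr].
    by rewrite big_nil; under eq_fun do rewrite big_nil;
      apply: cvg_cst; exact: nbhs_filter.
  rewrite big_cons; under eq_fun do rewrite big_cons.
  apply: cvgD IHr; apply: cvgM (cvg_cst _); exact: coord_continuous.
by apply/funext => v; rewrite dotE.
Qed.

(** The scalar difference quotient is the vector one paired with [w], and pairing with [w] is
    continuous, so the limit passes through. *)
Lemma is_derive_line m n (f : 'rV[R]_m -> 'rV[R]_n) w v y t :
  differentiable f (t *: v + y) ->
  is_derive t 1 (fun s : R => dot (f (s *: v + y)) w)
    (dot ('D_v f (t *: v + y)) w).
Proof.
move=> /(@diff_derivable _ _ _ _ _ v) df.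
pose quot (h : R) := h^-1 *:
  (((fun s => dot (f (s *: v + y)) w) \o shift t) (h *: 1)
   - dot (f (t *: v + y)) w).
have quotE : quot = (fun u => dot u w) \o (fun h : R => h^-1 *:
      ((f \o shift (t *: v + y)) (h *: v) - f (t *: v + y))).
  apply/funext => h /=; rewrite /quot/= dotZl dotBl.
  congr (_ * (dot (f _) _ - _)).
  by rewrite scalerDl addrA [_%:A]mulr1.
have cvgq : quot @ 0^' --> dot ('D_v f (t *: v + y)) w.
  rewrite quotE; apply: continuous_cvg; first exact: continuous_dotl.
  exact: df.
by apply: DeriveDef; [apply/cvg_ex; eexists; exact: cvgq|exact/cvg_lim].
Qed.

(** If [h2 > 0], then [h1 t / t] is positive for small [t != 0], so [h1 > 0] just to the right of 0.
    The mean value theorem on [[0, s]] then gives [h s > h 0]. *)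
Lemma second_derivative_test (h h1 : R -> R) (h2 e : R) : 0 < e ->
  (forall t : R, `|t| < e -> is_derive t 1 h (h1 t)) ->
  is_derive (0 : R) 1 h1 h2 -> (forall t, `|t| < e -> h t <= h 0) ->
  h1 0 = 0 /\ h2 <= 0.
Proof.
move=> e0 dh dh1 hmax.
have h10 : h1 0 = 0.
  have dh0 : is_derive (0 : R) 1 h 0.
    apply: (@derive1_at_max _ _ (- e) e).
    - by lra.
    - by move=> t; rewrite in_itv/= -ltr_norml => /dh[].
    - by rewrite in_itv/=; lra.
    - by move=> t; rewrite in_itv/= -ltr_norml; exact: hmax.
  have [_ <-] := dh 0 ltac:(by rewrite normr0).
  by have [_] := dh0.
split=> //; rewrite leNgt; apply/negP => h20.
have [d /= d0 dP] : \forall t \near 0^', 0 < t^-1 *: (h1 t - h1 0).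
  have [ch1 eh1] := dh1.
  have : (fun t => t^-1 *: ((h1 \o shift 0) (t *: 1) - h1 0)) @ 0^' --> h2.
    by rewrite -eh1; exact: ch1.
  move/cvgr_gt/(_ _ h20); apply: filterS => t /=.
  by rewrite addr0 [_%:A]mulr1.
pose s := Num.min d e / 2.
have m0 : 0 < Num.min d e by rewrite lt_min d0 e0.
have s0 : 0 < s by rewrite divr_gt0.
have [md me] : Num.min d e <= d /\ Num.min d e <= e.
  by rewrite !ge_min !lexx orbT.
have sd : s < d by rewrite /s; lra.
have se : s < e by rewrite /s; lra.
have [||c] := @MVT _ h h1 0 s s0.
- by move=> x; rewrite in_itv/= => /andP[x0 xs]; apply: dh;
  rewrite ger0_norm; lra.
- apply: continuous_in_subspaceT => x; rewrite inE/= in_itv/= => /andP[x0 xs].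
  apply/differentiable_continuous/derivable1_diffP.
  by have [] := dh x ltac:(by rewrite ger0_norm; lra).
rewrite in_itv/= => /andP[c0 cs].
have := hmax s; rewrite (ger0_norm (ltW s0)) => /(_ se) hs hE.
have := dP c; rewrite /ball_/= sub0r normrN (ger0_norm (ltW c0)).
move=> /(_ ltac:(lra)).
rewrite (gt_eqF c0) h10 subr0 pmulr_rgt0 ?invr_gt0// => /(_ isT) h1c.
have : 0 < h1 c * (s - 0) by rewrite mulr_gt0// subr0.
by rewrite -hE; lra.
Qed.

Lemma derive_row_sum m n (f : 'rV[R]_m -> 'rV[R]_n) (v x : 'rV[R]_m) :
  differentiable f x ->
  'D_v f x = \sum_j v 0 j *: 'D_(delta_mx 0 j) f x.
Proof.
move=> df; rewrite !deriveE// {1}(row_sum_delta v) linear_sum.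
by apply: eq_bigr => j _; rewrite linearZ deriveE.
Qed.

(** The expansion of the inner derivative in coordinates holds on all of [U], hence near [x], so it
    may be differentiated once more. *)
Lemma derive2_row_sum m n (f : 'rV[R]_m -> 'rV[R]_n) U (v x : 'rV[R]_m) :
  open U -> U x -> Ck_on 2 U f ->
  'D_v ('D_v f) x = \sum_i \sum_j
    (v 0 i * v 0 j) *: 'D_(delta_mx 0 i) ('D_(delta_mx 0 j) f) x.
Proof.
move=> Uo Ux [df d2f].
have -> : 'D_v ('D_v f) x =
    'D_v (\sum_j v 0 j *: ('D_(delta_mx 0 j) f : 'rV[R]_m -> 'rV[R]_n)) x.
  apply: near_eq_derive; near=> y; rewrite derive_row_sum.
    by rewrite fct_sumE.
  by apply: df; near: y; exact: open_nbhs_nbhs.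
have ddf j : differentiable ('D_(delta_mx 0 j) f) x.
  by have [+ _] := d2f (delta_mx 0 j); apply.
rewrite derive_sum => [|j]; last exact/derivableZ/diff_derivable.
rewrite exchange_big/=; apply: eq_bigr => j _.
rewrite deriveZ; last exact: diff_derivable.
rewrite derive_row_sum// scaler_sumr; apply: eq_bigr => i _.
by rewrite scalerA mulrC.
Unshelve. all: by end_near. Qed.

End Calculus.

(** * Mean curvature in a frame, and the chain rule for the barrier *)

Section Curvature.
Variable R : realType.

(* The rows of V are orthonormal for the first fundamental form.  The diagonal
   terms D_v D_v suffice to express the trace, so the symmetry of second
   derivatives is never needed. *)
Lemma frame_mean_curvature (X N : 'rV[R]_2 -> 'rV[R]_3) U x (V : 'M[R]_2) :
  open U -> U x -> Ck_on 2 U X -> V *m first_form X x *m V^T = 1%:M ->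
  mean_curvature X N x =
    - \sum_k dot ('D_(row k V) ('D_(row k V) X) x) (N x).
Proof.
move=> Uo Ux CX Vg1.
rewrite /mean_curvature /shape_operator (mxtrace_frame _ Vg1).
rewrite -sumrN; apply: eq_bigr => k _.
rewrite (derive2_row_sum _ Uo Ux CX) dot_suml -sumrN -mulmxA mxE.
apply: eq_bigr => i _.
rewrite dot_suml -sumrN [X in _ * X = _]mxE mulr_sumr; apply: eq_bigr => j _.
by rewrite dotZl !mxE; ring.
Qed.

(** Stacking [T] and [N] gives a square matrix [O] with [O O^T = 1]. Hence [O^T O = 1], that is,
    [T^T T + N^T N = 1]. *)
Lemma tangent_normal_dot (T : 'M[R]_(2, 3)) (N u w : 'rV[R]_3) :
  T *m T^T = 1%:M -> dot N N = 1 -> N *m T^T = 0 ->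
  dot u w = \sum_k dot u (row k T) * dot w (row k T) + dot u N * dot w N.
Proof.
move=> TT NN NT.
have TN : T *m N^T = 0 by rewrite -[RHS]trmx0 -NT trmx_mul trmxK.
have NN1 : N *m N^T = 1%:M by rewrite [LHS]mx11_scalar -/(dot N N) NN.
have OO : col_mx T N *m (col_mx T N)^T = 1%:M :> 'M[R]_(2 + 1).
  by rewrite tr_col_mx mul_col_row TT TN NT NN1 -scalar_mx_block.
have {OO} := mulmx1C OO; rewrite tr_col_mx mul_row_col => OO.
have -> : dot u w = dot (u *m (T^T *m T + N^T *m N)) w by rewrite OO mulmx1.
rewrite mulmxDr dotDl; congr (_ + _).
  rewrite /dot mulmxA -mulmxA mxE; apply: eq_bigr => k _; congr (_ * _).
    by rewrite [LHS]mulmx_trE row_id.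
  by rewrite [LHS]mulmx_trE row_id dotC.
by rewrite /dot mulmxA -mulmxA mxE big_ord1 -/(dot N w) dotC.
Qed.

(** Here [a], [b], [c] stand for the coordinates of the surface along a line in a chart; the claim
    is the second derivative test for [a - f b - g c]. *)
Lemma barrier_second_derivative (a b c a1 b1 c1 f f1 g g1 : R -> R)
    (a2 b2 c2 f2 g2 e : R) : 0 < e ->
  (forall t, `|t| < e -> is_derive t (1 : R) a (a1 t)) ->
  (forall t, `|t| < e -> is_derive t (1 : R) b (b1 t)) ->
  (forall t, `|t| < e -> is_derive t (1 : R) c (c1 t)) ->
  is_derive (0 : R) (1 : R) a1 a2 ->
  is_derive (0 : R) (1 : R) b1 b2 ->
  is_derive (0 : R) (1 : R) c1 c2 ->
  (forall x, is_derive x (1 : R) f (f1 x)) -> is_derive (b 0) (1 : R) f1 f2 ->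
  (forall x, is_derive x (1 : R) g (g1 x)) -> is_derive (c 0) (1 : R) g1 g2 ->
  (forall t, `|t| < e -> a t - f (b t) - g (c t) <= a 0 - f (b 0) - g (c 0)) ->
  a1 0 - f1 (b 0) * b1 0 - g1 (c 0) * c1 0 = 0 /\
  a2 - (f1 (b 0) * b2 + f2 * b1 0 ^+ 2) - (g1 (c 0) * c2 + g2 * c1 0 ^+ 2) <= 0.
Proof.
move=> e0 da db dc da1 db1 dc1 df df1 dg dg1 hmax.
apply: (@second_derivative_test _ (fun t => a t - f (b t) - g (c t))
  (fun t => a1 t - f1 (b t) * b1 t - g1 (c t) * c1 t) _ e) => //.
- move=> t te.
  have := da t te; have := db t te; have := dc t te => dct dbt dat.
  have dfb := is_derive1_comp (df (b t)) dbt.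
  have dgc := is_derive1_comp (dg (c t)) dct.
  exact: is_deriveB.
- have db0 := db 0 ltac:(by rewrite normr0).
  have dc0 := dc 0 ltac:(by rewrite normr0).
  have dfb := is_deriveM (is_derive1_comp df1 db0) db1.
  have dgc := is_deriveM (is_derive1_comp dg1 dc0) dc1.
  apply: is_derive_eq (is_deriveB (is_deriveB da1 dfb) dgc) _.
  by rewrite /GRing.scale /=; ring.
Qed.
End Curvature.

(** * The maximum principle on a translater *)

Section MaximumPrinciple.
Variables (R : realType) (S : smooth_surface R) (F : S -> 'rV[R]_3).
Local Notation w3 := (e3 R).
Variables w1 w2 : 'rV[R]_3.
Hypotheses (w11 : dot w1 w1 = 1) (w22 : dot w2 w2 = 1) (w12 : dot w1 w2 = 0).
Hypotheses (w13 : dot w1 w3 = 0) (w23 : dot w2 w3 = 0).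
Variables f f1 f2 g g1 g2 : R -> R.
Hypothesis df : forall x, is_derive x (1 : R) f (f1 x).
Hypothesis df1 : forall x, is_derive x (1 : R) f1 (f2 x).
Hypothesis dg : forall x, is_derive x (1 : R) g (g1 x).
Hypothesis dg1 : forall x, is_derive x (1 : R) g1 (g2 x).

Let u (y : 'rV[R]_3) := dot y w1 - f (dot y w2) - g (dot y w3).

(** The vector [w1 - f1 s *: w2 - g1 z *: w3] is the gradient of [u] at [X y]; the test is applied
    along the line [t *: v + y]. *)
Lemma chart_max_second_derivative (X : 'rV[R]_2 -> 'rV[R]_3) U y v :
  open U -> U y -> Ck_on 2 U X -> (forall y', U y' -> u (X y') <= u (X y)) ->
  let s := dot (X y) w2 in let z := dot (X y) w3 in
  dot ('D_v X y) (w1 - f1 s *: w2 - g1 z *: w3) = 0 /\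
  dot ('D_v ('D_v X) y) (w1 - f1 s *: w2 - g1 z *: w3) <=
    f2 s * dot ('D_v X y) w2 ^+ 2 + g2 z * dot ('D_v X y) w3 ^+ 2.
Proof.
move=> Uo Uy [dX d2X] ymax s z.
have [e /= e0 eU] : \forall t \near (0 : R), U (t *: v + y).
  have cl : (fun t : R => t *: v + y) @ (0 : R) --> y.
    rewrite -[X in _ --> X]add0r -(scale0r v); apply: cvgD; last first.
      by apply: cvg_cst; exact: nbhs_filter.
    by apply: cvgZr_tmp; exact: cvg_id.
  by apply: cl; exact: open_nbhs_nbhs.
have {}eU t : `|t| < e -> U (t *: v + y).
  by move=> te; apply: eU; rewrite /ball_/= sub0r normrN.
have line0 : 0 *: v + y = y by rewrite scale0r add0r.
have d1 w t : `|t| < e ->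
    is_derive t (1 : R) (fun t : R => dot (X (t *: v + y)) w)
    (dot ('D_v X (t *: v + y)) w).
  by move=> te; apply: is_derive_line; exact/dX/eU.
have d2 w : is_derive (0 : R) (1 : R) (fun t : R => dot ('D_v X (t *: v + y)) w)
    (dot ('D_v ('D_v X) y) w).
  rewrite -[in X in is_derive _ _ _ X]line0.
  by apply: is_derive_line; rewrite line0; have [+ _] := d2X v; apply.
have [| | |] := @barrier_second_derivative R _ _ _ _ _ _ f f1 g g1 _ _ _
  (f2 s) (g2 z) e e0 (d1 w1) (d1 w2) (d1 w3) (d2 w1) (d2 w2) (d2 w3) df _ dg.
- by rewrite line0; exact: df1.
- by rewrite line0; exact: dg1.
- by move=> t te; rewrite line0; apply: ymax; exact: eU.
rewrite line0 -/s -/z => H1 H2; split.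
- by rewrite !(dotBr, dotZr).
- rewrite !(dotBr, dotZr) -subr_le0; apply: le_trans H2.
  by rewrite le_eqVlt; apply/orP; left; apply/eqP; ring.
Qed.

(** At a maximum the gradient [G] of [u] is [l] times the unit normal. Summing the second derivative
    inequalities over an orthonormal tangent frame leaves on the left [l] times minus the mean
    curvature, which the translater equation turns into [dot G w3 = - g1 z]. *)
Lemma translater_max_principle p : translater F ->
  (forall p', u (F p') <= u (F p)) ->
  forall s z Q, s = dot (F p) w2 -> z = dot (F p) w3 ->
  Q = 1 + f1 s ^+ 2 + g1 z ^+ 2 ->
  0 <= g1 z + f2 s * (1 - f1 s ^+ 2 / Q) + g2 z * (1 - g1 z ^+ 2 / Q).
Proof.
move=> [[Fsm Fimm] Ftr] pmax _ _ _ -> -> ->.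
set s := dot (F p) w2; set z := dot (F p) w3.
set Q := 1 + f1 s ^+ 2 + g1 z ^+ 2.
have [c ac cp] := atlas_cover p.
have [W [nu [Wo Wp [nusm nu1 nuJ] Heq]]] := Ftr p.
pose X := F \o chart_inv c; pose N := nu \o chart_inv c; pose y := c p.
pose U := c @` chart_dom c.
have Uo : open U by exact: chart_img_open.
have Uy : U y by exists p.
have CX : Ck_on 2 U X by have := Fsm c ac; rewrite setIT; apply.
have Xy : X y = F p by rewrite /X/= chart_mapK.
have Ny : N y = nu p by rewrite /N/= chart_mapK.
have ymax y' : U y' -> u (X y') <= u (X y) by rewrite Xy => _; exact: pmax.
pose J := 'J X y.
have [V Vg1] := exists_orthonormal_frame (Fimm c p ac cp).
pose T := V *m J.
have TT : T *m T^T = 1%:M by rewrite trmx_mul -[RHS]Vg1 !mulmxA.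
have NN : dot (nu p) (nu p) = 1 by rewrite -enorm_sqr nu1// expr1n.
have NT : nu p *m T^T = 0 by rewrite trmx_mul mulmxA nuJ// mul0mx.
pose G := w1 - f1 s *: w2 - g1 z *: w3.
have DT k : 'D_(row k V) X y = row k T.
  by rewrite row_mul deriveEjacobian//; have [+ _] := CX; apply.
have test k : dot (row k T) G = 0 /\
    dot ('D_(row k V) ('D_(row k V) X) y) G <=
    f2 s * dot (row k T) w2 ^+ 2 + g2 z * dot (row k T) w3 ^+ 2.
  by have := chart_max_second_derivative (row k V) Uo Uy CX ymax; rewrite Xy DT.
pose l := dot G (nu p).
have Gl w : dot G w = l * dot (nu p) w.
  rewrite (tangent_normal_dot _ _ TT NN NT) big1 ?add0r ?(dotC w)// => k _.
  by rewrite dotC (test k).1 mul0r.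
have GG : dot G G = Q.
  rewrite /G !(dotBr, dotBl, dotZl, dotZr) w11 w22 dot_e3_e3 w12 w13 w23.
  by rewrite !(dotC w2 w1) !(dotC w3 w1) (dotC w3 w2) w12 w13 w23 /Q; ring.
have G2 : dot G w2 = - f1 s.
  by rewrite /G !(dotBl, dotZl) w22 w12 (dotC w3 w2) w23; ring.
have G3 : dot G w3 = - g1 z.
  by rewrite /G !(dotBl, dotZl) dot_e3_e3 w13 w23; ring.
have l2 : l ^+ 2 = Q by rewrite expr2 -GG [RHS]Gl (dotC _ G).
have Q0 : Q != 0.
  by rewrite gt_eqF// ltr_pwDl// ?sqr_ge0// ltr_pwDl// sqr_ge0.
(* The squared length of the tangential part of a unit vector is 1 minus that of its normal part. *)
have sumT w : dot w w = 1 ->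
    \sum_k dot (row k T) w ^+ 2 = 1 - dot G w ^+ 2 / Q.
  move=> ww; rewrite (Gl w) exprMn l2 mulrAC divff// mul1r.
  have := tangent_normal_dot w w TT NN NT; rewrite ww => ->.
  rewrite (dotC w) -expr2 addrK; apply: eq_bigr => k _.
  by rewrite (dotC w) expr2.
have H := frame_mean_curvature N Uo Uy CX Vg1.
rewrite Heq// Ny in H.
have {H} : g1 z + \sum_k dot ('D_(row k V) ('D_(row k V) X) y) G = 0.
  have -> : \sum_k dot ('D_(row k V) ('D_(row k V) X) y) G =
      l * \sum_k dot ('D_(row k V) ('D_(row k V) X) y) (nu p).
    by rewrite mulr_sumr; apply: eq_bigr => k _; rewrite dotC Gl dotC.
  move/oppr_inj : H => <-; rewrite -Gl G3; ring.
have : \sum_k dot ('D_(row k V) ('D_(row k V) X) y) G <=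
    f2 s * (1 - f1 s ^+ 2 / Q) + g2 z * (1 - g1 z ^+ 2 / Q).
  rewrite -(sqrrN (f1 s)) -G2 -sumT// -(sqrrN (g1 z)) -G3 -sumT ?dot_e3_e3//.
  by rewrite !mulr_sumr -big_split; apply: ler_sum => k _; exact: (test k).2.
lra.
Qed.

End MaximumPrinciple.

(** * The barrier functions and their derivatives *)

Section Barrier.
Variable R : realType.
Variables (eps k c B eta M : R).
Hypothesis k0 : 0 < k.

Definition side_barrier x : R := eps * ln (1 + k * (x - c) ^+ 2).
Definition side_barrier' x : R :=
  eps * (2 * k * (x - c) / (1 + k * (x - c) ^+ 2)).
Definition side_barrier'' x : R :=
  eps * (2 * k * (1 - k * (x - c) ^+ 2) / (1 + k * (x - c) ^+ 2) ^+ 2).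

Definition height_barrier z : R :=
  eps * (B * expR (- (z - M) / 2) + eta * (z - M)).
Definition height_barrier' z : R :=
  eps * (- (B / 2) * expR (- (z - M) / 2) + eta).
Definition height_barrier'' z : R := eps * (B / 4 * expR (- (z - M) / 2)).

Let quad_gt0 x : 0 < 1 + k * (x - c) ^+ 2.
Proof. by rewrite ltr_pwDl// mulr_ge0 ?sqr_ge0// ltW. Qed.

Let is_derive_quad x :
  is_derive x (1 : R) (fun x => 1 + k * (x - c) ^+ 2) (2 * k * (x - c)).
Proof.
apply: is_derive_eq.
by rewrite /GRing.scale /=; ring.
Qed.

Lemma is_derive_side_barrier x :
  is_derive x (1 : R) side_barrier (side_barrier' x).
Proof.
have dln := @is_derive1_comp R (@ln R) (fun x => 1 + k * (x - c) ^+ 2) x _ _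
  (is_derive1_ln (quad_gt0 x)) (is_derive_quad x).
apply: is_derive_eq (is_deriveZ eps dln) _.
by rewrite /side_barrier' /GRing.scale /=; ring.
Qed.

Lemma is_derive_side_barrier' x :
  is_derive x (1 : R) side_barrier' (side_barrier'' x).
Proof.
have q0 := quad_gt0 x; have qn0 : 1 + k * (x - c) ^+ 2 != 0 by rewrite gt_eqF.
have dV := @is_deriveV R (fun x => 1 + k * (x - c) ^+ 2) x _ _ qn0
  (is_derive_quad x).
have dl : is_derive x (1 : R) (fun x => 2 * k * (x - c)) (2 * k).
  by apply: is_derive_eq; rewrite /GRing.scale /=; ring.
apply: is_derive_eq (is_deriveZ eps (is_deriveM dl dV)) _.
by rewrite /side_barrier'' /GRing.scale /=; field.
Qed.

Let is_derive_exp z : is_derive z (1 : R) (fun z => expR (- (z - M) / 2))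
  (- (1 / 2) * expR (- (z - M) / 2)).
Proof.
have dl : is_derive z (1 : R) (fun z => - (z - M) / 2) (- (1 / 2)).
  by apply: is_derive_eq; rewrite /GRing.scale /=; ring.
apply: is_derive_eq (@is_derive1_comp R expR (fun z => - (z - M) / 2) z _ _
  (is_derive_expR _) dl) _.
exact: mulrC.
Qed.

Lemma is_derive_height_barrier z :
  is_derive z (1 : R) height_barrier (height_barrier' z).
Proof.
have dl : is_derive z (1 : R) (fun z => eta * (z - M)) eta.
  by apply: is_derive_eq; rewrite /GRing.scale /=; ring.
have dBe := is_deriveZ B (is_derive_exp z).
apply: is_derive_eq (is_deriveZ eps (is_deriveD dBe dl)) _.
by rewrite /height_barrier' /GRing.scale /=; field.
Qed.

Lemma is_derive_height_barrier' z :
  is_derive z (1 : R) height_barrier' (height_barrier'' z).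
Proof.
have de := is_deriveZ (- (B / 2)) (is_derive_exp z).
apply: is_derive_eq (is_deriveZ eps (is_deriveD de (is_derive_cst eta z 1))) _.
by rewrite /height_barrier'' /GRing.scale /=; field.
Qed.

End Barrier.

(** * Size of the barrier and sign of the operator on it *)

Section BarrierEstimates.
Variable R : realType.
Implicit Types eps k c B eta M x z Y P : R.

Lemma side_barrier_ge0 eps k c x : 0 <= eps -> 0 <= k ->
  0 <= side_barrier eps k c x.
Proof.
move=> e0 k0; rewrite mulr_ge0// ln_ge0// lerDl mulr_ge0// sqr_ge0//.
Qed.

(** For [x < 0], [exp (- x / 2) >= 1 - x / 2] makes the first term at least [4 - 2 x], while
    [eta * x >= x / 2]. *)
Lemma height_profile_ge0 B eta x : 4 <= B -> 0 <= eta <= 1 / 2 ->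
  0 <= B * expR (- x / 2) + eta * x.
Proof.
move=> B4 /andP[eta0 eta2].
have E0 := expR_gt0 (- x / 2).
have E1 := expR_ge1Dx (- x / 2).
have [x0|x0] := leP 0 x; first by rewrite addr_ge0// mulr_ge0//; lra.
nra.
Qed.

Lemma height_barrier_ge0 eps B eta M z : 0 <= eps -> 4 <= B ->
  0 <= eta <= 1 / 2 -> 0 <= height_barrier eps B eta M z.
Proof. by move=> e0 B4 ?; rewrite mulr_ge0//; apply: height_profile_ge0. Qed.

(** The linear term controls large positive [x]; for [x < 0] the exponential makes the profile at
    least [- x]. *)
Lemma height_profile_coercive B eta x L : 4 <= B -> 0 < eta <= 1 / 2 ->
  B * expR (- x / 2) + eta * x <= L -> - L <= x <= L / eta.
Proof.
move=> B4 /andP[eta0 eta2] H.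
have E0 := expR_gt0 (- x / 2).
have E1 := expR_ge1Dx (- x / 2).
apply/andP; split; last by rewrite ler_pdivlMr//; nra.
have := @height_profile_ge0 B eta x B4 ltac:(lra) => P0.
have [x0|x0] := leP 0 x; first by lra.
nra.
Qed.

(** With [A = a^2] and [B = b^2] the factor is [(1 + B) / (1 + A + B)], and
    [(1 + A) (1 + B) >= 1 + A + B]. *)
Lemma tangential_factor_bounds (a b : R) :
  (1 + a ^+ 2)^-1 <= 1 - a ^+ 2 / (1 + a ^+ 2 + b ^+ 2) <= 1.
Proof.
have a0 := sqr_ge0 a; have b0 := sqr_ge0 b.
set A := a ^+ 2 in a0 *; set B := b ^+ 2 in b0 *.
have Q0 : 0 < 1 + A + B by lra.
have A0 : 0 < 1 + A by lra.
apply/andP; split; last by rewrite gerBl divr_ge0// ltW.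
have -> : 1 - A / (1 + A + B) = (1 + B) / (1 + A + B) by field; rewrite gt_eqF.
rewrite ler_pdivlMr// ler_pdivrMl//; nra.
Qed.

(** For [eps = 1] this is [4 k y^2 <= (1 + k y^2)^2], whose two sides differ by [(1 - k y^2)^2]. *)
Lemma side_barrier'_sqr_le eps k c x : 0 < eps <= 1 -> 0 < k ->
  side_barrier' eps k c x ^+ 2 <= k.
Proof.
move=> /andP[e0 e1] k0; rewrite /side_barrier'.
set y := x - c; have y0 := sqr_ge0 y.
set X := 1 + k * y ^+ 2.
have X0 : 0 < X by rewrite /X; nra.
have -> : (eps * (2 * k * y / X)) ^+ 2 =
    eps ^+ 2 * (4 * k ^+ 2 * y ^+ 2 / X ^+ 2).
  by field; rewrite gt_eqF.
have H : 4 * k ^+ 2 * y ^+ 2 / X ^+ 2 <= k.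
  rewrite ler_pdivrMr ?exprn_gt0// /X.
  rewrite -subr_ge0 (_ : _ - _ = k * (1 - k * y ^+ 2) ^+ 2); last by ring.
  apply: mulr_ge0; [exact: ltW|exact: sqr_ge0].
have H0 : 0 <= 4 * k ^+ 2 * y ^+ 2 / X ^+ 2.
  by rewrite divr_ge0 ?sqr_ge0// -mulrA -exprMn mulr_ge0// sqr_ge0.
have : eps ^+ 2 <= 1 by rewrite expr_le1// ltW.
have := sqr_ge0 eps.
nra.
Qed.

(* The factors 1 - a^2 / (1 + a^2 + b^2) and 1 - b^2 / (1 + a^2 + b^2) are the
   squared lengths of the tangential parts of the x2- and x3-directions at a
   point where the gradient (1, -a, -b) of the barrier is normal. *)
Lemma barrier_operator_lt0 eps k c B eta M Y x z :
    0 < eps <= 1 -> 0 < k -> B = 4 * (2 * k + 1) ->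
    0 < eta <= 1 / 2 -> eta < 6 * k / (Y ^+ 2 * (1 + k)) ->
    1 + k * (x - c) ^+ 2 <= Y ->
    z <= M \/ 4 <= k * (x - c) ^+ 2 ->
  forall a b, a = side_barrier' eps k c x ->
    b = height_barrier' eps B eta M z ->
  b + side_barrier'' eps k c x * (1 - a ^+ 2 / (1 + a ^+ 2 + b ^+ 2)) +
    height_barrier'' eps B M z * (1 - b ^+ 2 / (1 + a ^+ 2 + b ^+ 2)) < 0.
Proof.
move=> /andP[e0 e1] k0 BE /andP[eta0 eta2] etaY XY zx a b aE bE.
set Q := 1 + a ^+ 2 + b ^+ 2.
have /andP[Flo Fhi] := tangential_factor_bounds a b; rewrite -/Q in Flo Fhi.
have /andP[Glo Ghi] := tangential_factor_bounds b a.
rewrite addrAC -/Q in Glo Ghi.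
have a2k : a ^+ 2 <= k by rewrite aE side_barrier'_sqr_le// e0.
have a20 := sqr_ge0 a.
set Fa := 1 - _ in Flo Fhi *; set Fb := 1 - _ in Glo Ghi *.
have Fa0 : 0 < Fa by apply: lt_le_trans Flo; rewrite invr_gt0; lra.
set E := expR (- (z - M) / 2).
have E0 : 0 < E by exact: expR_gt0.
(* The exponential contributes [- B / 2] through the drift and at most [B / 4] through the second
   derivative; the choice of [B] makes the sum [- (2 k + 1)]. *)
have hE : b + height_barrier'' eps B M z * Fb <=
    eps * (- (2 * k + 1) * E + eta).
  have h2 : height_barrier'' eps B M z * Fb <= eps * (B / 4 * E).
    by rewrite /height_barrier'' -/E ler_piMr// !mulr_ge0// ?ltW// BE; lra.
  have -> : eps * (- (2 * k + 1) * E + eta) = b + eps * (B / 4 * E).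
    by rewrite bE /height_barrier' -/E BE; field.
  by rewrite lerD2l.
set y2 := (x - c) ^+ 2 in XY zx.
have y20 : 0 <= y2 by exact: sqr_ge0.
set X := 1 + k * y2 in XY.
have X1 : 1 <= X by rewrite /X lerDl mulr_ge0// ltW.
have sE : side_barrier'' eps k c x =
  eps * (2 * k * (1 - k * y2) / X ^+ 2) by [].
have kY : 0 < eps * (2 * k) by rewrite mulr_gt0//; lra.
have X2 : 1 <= X ^+ 2 by rewrite exprn_ege1.
(* If [z <= M], then [E >= 1] and the right side exceeds [2 k eps], an upper bound for the left.
   Otherwise [1 - k y2 <= -3] and [Fa >= 1 / (1 + k)] make the left side at most
   [- eps * 6 k / (Y^2 (1 + k))], which is below [- eps * eta]. *)
have sfac : side_barrier'' eps k c x * Fa < eps * ((2 * k + 1) * E - eta).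
  rewrite sE; case: zx => [zM|ky4].
    have E1 : 1 <= E by rewrite /E -[leLHS]expR0 ler_expR; lra.
    have : 2 * k * (1 - k * y2) / X ^+ 2 * Fa <= 2 * k.
      have : 2 * k * (1 - k * y2) / X ^+ 2 <= 2 * k.
        rewrite ler_pdivrMr; last by lra.
        have : 0 <= k * y2 by rewrite mulr_ge0// ltW.
        nra.
      nra.
    rewrite -[ltLHS]mulrA ltr_pM2l//; nra.
  have Y2 : X ^+ 2 <= Y ^+ 2 by rewrite ler_pXn2r ?nnegrE//; lra.
  have : 2 * k * (1 - k * y2) / X ^+ 2 * Fa <= - (6 * k / (Y ^+ 2 * (1 + k))).
    have q : 2 * k * (1 - k * y2) / X ^+ 2 <= - (6 * k / Y ^+ 2).
      rewrite lerNr -mulNr; apply: (@le_trans _ _ (6 * k / X ^+ 2)).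
        by rewrite ler_wpM2l ?lef_pV2 ?posrE//; lra.
      by rewrite ler_wpM2r ?invr_ge0//; [lra|nra].
    have q2 : (1 + k)^-1 <= Fa.
      by apply: le_trans Flo; rewrite lef_pV2 ?posrE; lra.
    have p0 : 0 < 6 * k / Y ^+ 2 by rewrite divr_gt0//; lra.
    have k1 : 0 < (1 + k)^-1 by rewrite invr_gt0; lra.
    rewrite invfM mulrA; nra.
  rewrite -[ltLHS]mulrA ltr_pM2l//; nra.
rewrite addrAC.
have -> : 0 = eps * (- (2 * k + 1) * E + eta) + eps * ((2 * k + 1) * E - eta).
  by ring.
exact: ler_ltD.
Qed.
End BarrierEstimates.

(** * Compactness, continuity and maxima of coercive functions *)

Section Topology.
Variable R : realType.

Lemma continuous_dot_diag n : continuous (fun u : 'rV[R]_n => dot u u).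
Proof.
move=> u; rewrite (_ : (fun u => dot u u) = (fun u => \sum_i u 0 i * u 0 i)).
  rewrite /continuous_at; elim: (index_enum _) => [|i r IHr].
    by rewrite big_nil; under eq_fun do rewrite big_nil;
      apply: cvg_cst; exact: nbhs_filter.
  rewrite big_cons; under eq_fun do rewrite big_cons.
  by apply: cvgD IHr; apply: cvgM; exact: coord_continuous.
by apply/funext => v; rewrite dotE.
Qed.

Lemma compact_dot_le n (A : set 'rV[R]_n) M :
  closed A -> (forall y, A y -> dot y y <= M) -> compact A.
Proof.
move=> clA Abd; apply: bounded_closed_compact => //.
(* A number [t >= 0] with [t^2 <= M] satisfies [t <= 1 + M], which avoids a square root. *)
exists (1 + M); split; first exact: num_real.
move=> N MN y Ay /=; apply: le_trans (ltW MN).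
have yM := Abd y Ay; have M0 := le_trans (dot_ge0 y) yM.
rewrite [leLHS]/Num.Def.normr/= mx_normrE.
apply: bigmax_le => [|[i j] _ /=]; first by lra.
 rewrite (ord1 i).
have : `|y 0 j| ^+ 2 <= M.
  rewrite real_normK ?num_real//; apply: le_trans yM.
  rewrite dotE (bigD1 j)//= -expr2 lerDl sumr_ge0// => l _.
  by rewrite -expr2 sqr_ge0.
have := normr_ge0 (y 0 j); nra.
Qed.

Lemma sqr_le_bound (a b : R) : - b <= a <= b -> a ^+ 2 <= b ^+ 2.
Proof. by move=> /andP[ba ab]; nra. Qed.

Lemma closed_dot_le n M : closed [set y : 'rV[R]_n | dot y y <= M].
Proof.
apply: (@preimage_closed _ _ (fun y : 'rV[R]_n => dot y y) [set x | x <= M]).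
  by move=> y _; exact: continuous_dot_diag.
exact: closed_le.
Qed.

Lemma immersion_continuous (S : smooth_surface R) (F : S -> 'rV[R]_3) :
  immersion F -> continuous F.
Proof.
move=> [Fsm _] p.
have [c ac cp] := atlas_cover p.
have Uy : (c @` chart_dom c) (c p) by exists p.
have Fc : {for c p, continuous (F \o chart_inv c)}.
  by have := Fsm c ac 0%N; rewrite setIT; apply.
have cc : {for p, continuous c}.
  have := @chart_map_cont _ _ c.
  rewrite continuous_open_subspace; last exact: chart_dom_open.
  by apply; rewrite inE.
have Fcc : (F \o chart_inv c) \o c @ p --> (F \o chart_inv c) (c p).
  exact: continuous_comp cc Fc.
rewrite /= chart_mapK// in Fcc.
apply: cvg_trans Fcc; apply: near_eq_cvg; near=> y.
rewrite /= chart_mapK//; near: y.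
by apply: open_nbhs_nbhs; split => //; exact: chart_dom_open.
Unshelve. all: by end_near. Qed.

Lemma is_derive_continuous (f : R -> R) (f' : R -> R) :
  (forall x, is_derive x (1 : R) f (f' x)) -> continuous f.
Proof.
move=> df x; apply/differentiable_continuous/derivable1_diffP.
by have [] := df x.
Qed.

(** The preimage of the ball is compact and contains [p0]; every point outside it has a value below
    that at [p0]. *)
Lemma proper_coercive_max (S : topologicalType) (F : S -> 'rV[R]_3)
    (u : 'rV[R]_3 -> R) p0 M :
  continuous F -> (forall K : set 'rV[R]_3, compact K -> compact (F @^-1` K)) ->
  continuous u ->
  (forall p, u (F p0) <= u (F p) -> dot (F p) (F p) <= M) ->
  exists p, forall p', u (F p') <= u (F p).
Proof.
move=> cF pF cu bd.
pose K := [set y : 'rV[R]_3 | dot y y <= M].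
have cK : compact (F @^-1` K).
  by apply: pF; apply: (@compact_dot_le _ _ M) => //; exact: closed_dot_le.
have [||p _ pmax] := @compact_EVT_max _ _ (u \o F) _ _ cK.
- by exists p0; exact: bd.
- by apply: continuous_subspaceT => p; apply: continuous_comp;
  [exact: cF|exact: cu].
have p0K : p0 \in F @^-1` K by rewrite inE; exact: bd.
exists p => p'; have [p'K|] := boolP (p' \in F @^-1` K); first exact: pmax.
rewrite notin_setE => p'K; apply: le_trans (pmax _ p0K); rewrite leNgt.
by apply/negP => /ltW /bd.
Qed.

End Topology.

(** * A translater of bounded height near one point avoids a slab *)

Section Slab.
Variables (R : realType) (S : smooth_surface R) (F : S -> 'rV[R]_3).
Variables (w1 w2 : 'rV[R]_3).
Hypotheses (w11 : dot w1 w1 = 1) (w22 : dot w2 w2 = 1) (w12 : dot w1 w2 = 0).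
Hypotheses (w13 : dot w1 (e3 R) = 0) (w23 : dot w2 (e3 R) = 0).

Lemma orthonormal_sum_sqr y :
  dot y y = dot y w1 ^+ 2 + dot y w2 ^+ 2 + dot y (e3 R) ^+ 2.
Proof.
pose T := col_mx w1 w2 : 'M[R]_(1 + 1, 3).
have e11 (v w : 'rV[R]_3) a : dot v w = a -> v *m w^T = a%:M.
  by move=> <-; rewrite [LHS]mx11_scalar.
have TT : T *m T^T = 1%:M :> 'M[R]_(1 + 1).
  rewrite tr_col_mx mul_col_row (e11 _ _ _ w11) (e11 _ _ _ w22) (e11 _ _ _ w12).
  by rewrite (e11 w2 w1 0) 1?dotC// !raddf0 -scalar_mx_block.
have NT : e3 R *m T^T = 0.
  rewrite tr_col_mx mul_mx_row (e11 _ _ 0) 1?dotC// (e11 _ _ 0) 1?dotC//.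
  by rewrite !raddf0 row_mx0.
rewrite (tangent_normal_dot y y TT (dot_e3_e3 R) NT) -expr2; congr (_ + _).
rewrite big_ord_recl big_ord1 -!expr2; congr (dot y _ ^+ 2 + dot y _ ^+ 2).
  by rewrite -[RHS](row_id 0) -(rowKu 0 w1 w2); congr row; exact/val_inj.
by rewrite -[RHS](row_id 0) -(rowKd 0 w1 w2); congr row; exact/val_inj.
Qed.

Lemma translater_slab_gap (c1 c2 r delta M : R) :
  translater F -> properly_immersed F -> 0 < r -> 0 < delta ->
  (forall p, dot (F p) w1 <= c1) ->
  (forall p, c1 - delta < dot (F p) w1 -> `|dot (F p) w2 - c2| < r ->
     dot (F p) (e3 R) <= M) ->
  forall p, dot (F p) w1 <= c1 - delta.
Proof.
move=> Ftr [Fimm Fprop] r0 delta0 Fc1 Fexcl p0.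
rewrite leNgt; apply/negP => p0gt.
(* With this [k], a distance at least [r] in the [w2] direction means [k * (x2 - c2)^2 >= 4]. *)
pose k := 4 / r ^+ 2; pose B := 4 * (2 * k + 1).
have k0 : 0 < k by rewrite divr_gt0// exprn_gt0.
have B4 : 4 <= B by rewrite /B; lra.
pose d0 := dot (F p0) w1 - (c1 - delta).
have d00 : 0 < d0 by rewrite subr_gt0.
pose a0 := ln (1 + k * (dot (F p0) w2 - c2) ^+ 2).
(* [eta] is chosen only after [eps], so [b0] bounds the height profile at [p0] for every admissible
   [eta]. *)
pose b0 := B * expR (- (dot (F p0) (e3 R) - M) / 2) + `|dot (F p0) (e3 R) - M|.
have a00 : 0 <= a0 by rewrite ln_ge0// lerDl mulr_ge0 ?sqr_ge0// ltW.
have b00 : 0 <= b0 by rewrite addr_ge0// mulr_ge0 ?expR_ge0//; lra.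
(* This gives [eps <= 1] and [eps * (a0 + b0) < d0], so the penalties keep [u (F p0)] above
   [c1 - delta]. *)
pose eps := d0 / (1 + d0 + a0 + b0).
have D0 : 0 < 1 + d0 + a0 + b0 by lra.
have eps0 : 0 < eps by rewrite divr_gt0.
have eps1 : eps <= 1 by rewrite ler_pdivrMr//; lra.
(* Where [u >= u (F p0)], each penalty is at most [delta], so the logarithm and the height profile
   are at most [L]. *)
pose L := delta / eps; pose Y := expR L.
have L0 : 0 < L by rewrite divr_gt0.
pose cY := 6 * k / (Y ^+ 2 * (1 + k)).
have cY0 : 0 < cY.
  have Y0 : 0 < Y ^+ 2 by rewrite exprn_gt0// expR_gt0.
  by apply: divr_gt0; first lra; apply: mulr_gt0 => //; lra.
(* The half of [cY] yields the strict bound [eta < cY]. *)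
pose eta := Num.min (1 / 2) (cY / 2).
have [eta2 etac] : eta <= 1 / 2 /\ eta <= cY / 2 by rewrite !ge_min !lexx orbT.
have eta0 : 0 < eta by rewrite lt_min; apply/andP; split; lra.
pose f := side_barrier eps k c2; pose g := height_barrier eps B eta M.
pose u (y : 'rV[R]_3) := dot y w1 - f (dot y w2) - g (dot y (e3 R)).
have f0 x : 0 <= f x by apply: side_barrier_ge0; exact: ltW.
have g0 x : 0 <= g x.
  by apply: height_barrier_ge0; rewrite ?(ltW eps0)// (ltW eta0).
have u0 : c1 - delta < u (F p0).
  have gb : g (dot (F p0) (e3 R)) <= eps * b0.
    rewrite /g /height_barrier ler_pM2l// lerD2l.
    have := ler_norm (dot (F p0) (e3 R) - M).
    have := normr_ge0 (dot (F p0) (e3 R) - M).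
    nra.
  have : eps * (a0 + b0) < d0.
    rewrite /eps mulrAC ltr_pdivrMr// ltr_pM2l//; lra.
  rewrite mulrDr -/(f (dot (F p0) w2)).
  rewrite /u /d0; move: gb; rewrite /f /side_barrier -/a0; lra.
have near_side p : u (F p0) <= u (F p) ->
    [/\ c1 - delta < dot (F p) w1,
        1 + k * (dot (F p) w2 - c2) ^+ 2 <= Y &
        M - L <= dot (F p) (e3 R) <= M + L / eta].
  move=> pu; have := lt_le_trans u0 pu; rewrite /u.
  have := f0 (dot (F p) w2); have := g0 (dot (F p) (e3 R)); have := Fc1 p.
  move=> xc gp fp uD; split; first by lra.
    have : f (dot (F p) w2) <= delta by lra.
    rewrite /f /side_barrier mulrC -ler_pdivlMr// -ler_expR lnK//.
    by rewrite posrE ltr_pwDl// mulr_ge0 ?sqr_ge0// ltW.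
  have : g (dot (F p) (e3 R)) <= delta by lra.
  rewrite /g /height_barrier mulrC -ler_pdivlMr// => gL.
  have := @height_profile_coercive _ B eta (dot (F p) (e3 R) - M) L B4 _ gL.
  by rewrite eta0 eta2 => /(_ isT); lra.
have df := is_derive_side_barrier eps c2 k0.
have df1 := is_derive_side_barrier' eps c2 k0.
have dg := is_derive_height_barrier eps B eta M.
have dg1 := is_derive_height_barrier' eps B eta M.
have ucont : continuous u.
  have ucomp (h : R -> R) (w : 'rV[R]_3) : continuous h ->
      continuous (fun y => h (dot y w)).
    by move=> ch y; apply: continuous_comp; [exact: continuous_dotl|exact: ch].
  move=> y; exact: (cvgB (cvgB (@continuous_dotl _ _ w1 y)
    (ucomp f w2 (is_derive_continuous df) y))
    (ucomp g (e3 R) (is_derive_continuous dg) y)).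
have [|p pmax] := @proper_coercive_max _ _ F u p0
  ((`|c1| + delta) ^+ 2 + 2 * (c2 ^+ 2 + Y / k) + (`|M| + L + L / eta) ^+ 2)
  (immersion_continuous Fimm) Fprop ucont.
  move=> p /near_side[x1 x2 /andP[x3l x3u]].
  have xc := Fc1 p.
  rewrite orthonormal_sum_sqr !lerD//.
  - apply: sqr_le_bound; have := ler_norm c1; have := ler_norm (- c1).
    by rewrite normrN; lra.
  - have yk : (dot (F p) w2 - c2) ^+ 2 <= Y / k.
      by rewrite ler_pdivlMr// mulrC; lra.
    (* This square is the slack in [t^2 <= 2 c2^2 + 2 (t - c2)^2]. *)
    have := sqr_ge0 (dot (F p) w2 - 2 * c2); nra.
  - have Leta : 0 < L / eta by rewrite divr_gt0.
    apply: sqr_le_bound; have := ler_norm M; have := ler_norm (- M).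
    by rewrite normrN; lra.
have [x1 x2 _] := near_side p (pmax p0).
have := translater_max_principle w11 w22 w12 w13 w23 df df1 dg dg1 Ftr pmax
  erefl erefl erefl.
rewrite leNgt => /negP; apply.
apply: (@barrier_operator_lt0 _ eps k c2 B eta M Y) => //.
- by rewrite eps0.
- by rewrite eta0.
- by rewrite -/cY; lra.
- have [near_axis|far] := ltP (`|dot (F p) w2 - c2|) r.
    by left; exact: Fexcl.
  right; rewrite /k mulrAC ler_pdivlMr ?exprn_gt0// ler_pM2l//.
  rewrite -[leRHS]real_normK ?num_real//; nra.
Qed.
End Slab.

(** * Closed convex hulls, nearest points and supporting lines *)

Section Convexity.
Variable R : realType.

Lemma convex_setE n (C : set 'rV[R]_n) : @convex_set R 'rV[R]_n C <->
  forall x y t, 0 <= t <= 1 -> C x -> C y -> C (t *: x + (1 - t) *: y).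
Proof.
split=> [cC x y t /andP[t0 t1] Cx Cy|cC x y t].
  have := cC x y (Itv01 t0 t1); rewrite !inE; apply; exact.
rewrite !inE => Cx Cy; apply: cC => //.
by apply/andP; split; [exact: ge0|exact: le1].
Qed.

Lemma closed_convex_hull_sub n (A : set 'rV[R]_n) :
  A `<=` closed_convex_hull A.
Proof. exact: sub_smallest. Qed.

Lemma closed_convex_hull_min n (A C : set 'rV[R]_n) :
  closed C -> @convex_set R 'rV[R]_n C -> A `<=` C ->
  closed_convex_hull A `<=` C.
Proof. by move=> clC cC AC; apply: smallest_sub. Qed.

Lemma closed_convex_hull_closed n (A : set 'rV[R]_n) :
  closed (closed_convex_hull A).
Proof. by apply: closed_bigI => C [[]]. Qed.

Lemma closed_convex_hull_convex n (A : set 'rV[R]_n) :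
  @convex_set R 'rV[R]_n (closed_convex_hull A).
Proof.
apply/convex_setE => x y t t01 Ax Ay C [[clC cC] AC].
by apply: (convex_setE C).1 => //; [apply: Ax|apply: Ay].
Qed.

Lemma closed_halfspace n (w : 'rV[R]_n) a : closed [set y | dot y w <= a].
Proof.
apply: (@preimage_closed _ _ (fun y : 'rV[R]_n => dot y w) [set x | x <= a]).
  by move=> y _; exact: continuous_dotl.
exact: closed_le.
Qed.

Lemma convex_halfspace n (w : 'rV[R]_n) a :
  @convex_set R 'rV[R]_n [set y | dot y w <= a].
Proof.
apply/convex_setE => x y t /andP[t0 t1] /= xa ya.
by rewrite dotDl !dotZl; nra.
Qed.

Lemma dot_add_le n (u v : 'rV[R]_n) :
  dot (u + v) (u + v) <= 2 * dot u u + 2 * dot v v.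
Proof.
have := dot_ge0 (u - v).
by rewrite dotBl !dotBr dotDl !dotDr (dotC v u); lra.
Qed.

Lemma continuous_sqdist n (z : 'rV[R]_n) :
  continuous (fun y : 'rV[R]_n => dot (y - z) (y - z)).
Proof.
move=> y; have -> : (fun y : 'rV[R]_n => dot (y - z) (y - z)) =
    (fun y : 'rV[R]_n => dot y y - 2 * dot y z + dot z z).
  by apply/funext => v; rewrite dotBl !dotBr (dotC z v); ring.
have cc (a : R) : (fun=> a) @ y --> a by apply: cvg_cst; exact: nbhs_filter.
exact: (cvgD (cvgB (@continuous_dot_diag _ _ y)
  (cvgM (cc 2) (@continuous_dotl _ _ z y))) (cc _)).
Qed.

(** Only the points of [K] no farther from [z] than a fixed [y0] compete, and they form a compact
    set. *)
Lemma exists_nearest_point n (K : set 'rV[R]_n) z : closed K -> K !=set0 ->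
  exists2 q, K q & forall y, K y -> dot (q - z) (q - z) <= dot (y - z) (y - z).
Proof.
move=> clK [y0 Ky0].
pose A := K `&` [set y | dot (y - z) (y - z) <= dot (y0 - z) (y0 - z)].
have Ay0 : A y0 by split => //=.
have cA : compact A.
  apply: (@compact_dot_le _ _ _ (2 * dot (y0 - z) (y0 - z) + 2 * dot z z)).
    apply: closedI => //.
    apply: (@preimage_closed _ _ (fun y : 'rV[R]_n => dot (y - z) (y - z))
      [set x | x <= dot (y0 - z) (y0 - z)]).
      by move=> y _; exact: continuous_sqdist.
    exact: closed_le.
  move=> y [_ /= yz]; have := dot_add_le (y - z) z; rewrite subrK; lra.
have [||q qA qmin] := @compact_EVT_min _ _
  (fun y : 'rV[R]_n => dot (y - z) (y - z)) A _ cA.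
- by exists y0.
- by apply: continuous_subspaceT; exact: continuous_sqdist.
move: qA; rewrite inE => -[Kq qy0]; exists q => // y Ky.
have [yy0|y0y] := leP (dot (y - z) (y - z)) (dot (y0 - z) (y0 - z)).
  by apply: qmin; rewrite inE; split.
exact: le_trans qy0 (ltW y0y).
Qed.

(** If [P > 0], moving from [q] towards [y] by [t = P / (P + Y)] changes the squared distance to [z]
    by [t^2 Y - 2 t P = - t P - t^2 P < 0]. *)
Lemma nearest_point_supporting n (K : set 'rV[R]_n) z q :
  @convex_set R 'rV[R]_n K -> K q ->
  (forall y, K y -> dot (q - z) (q - z) <= dot (y - z) (y - z)) ->
  forall y, K y -> dot (y - q) (z - q) <= 0.
Proof.
move=> /convex_setE cK Kq qmin y Ky; rewrite leNgt; apply/negP => yq.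
pose P := dot (y - q) (z - q); pose Y := dot (y - q) (y - q).
have Y0 : 0 <= Y by exact: dot_ge0.
pose t := P / (P + Y).
have PY : 0 < P + Y by rewrite ltr_wpDr.
have t0 : 0 < t by rewrite divr_gt0.
have t1 : t <= 1 by rewrite ler_pdivrMr// mul1r lerDl.
have := qmin _ (cK y q t _ Ky Kq); rewrite (ltW t0) t1 => /(_ isT).
have -> : t *: y + (1 - t) *: q - z = t *: (y - q) - (z - q).
  by apply/rowP => i; rewrite !mxE; ring.
have sqE (a b : 'rV[R]_n) : dot (t *: a - b) (t *: a - b) =
    t ^+ 2 * dot a a - 2 * t * dot a b + dot b b.
  by rewrite dotBl !dotBr !dotZl !dotZr (dotC b a); ring.
rewrite sqE -/P -/Y -(opprB z q) dotNl (dotC _ (- _)) dotNl opprK.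
have tY : t * Y = P - t * P.
  by rewrite /t; field; rewrite gt_eqF.
have t2Y : t ^+ 2 * Y = t * P - t ^+ 2 * P by rewrite expr2 -mulrA tY; ring.
have tP : 0 < t * P by rewrite mulr_gt0.
have t2P : 0 < t ^+ 2 * P by rewrite mulr_gt0// exprn_gt0.
lra.
Qed.

End Convexity.

(** * Horizontal vectors in space and rotation in the plane *)

Section Embedding.
Variable R : realType.

Definition horizontal (v : 'rV[R]_2) : 'rV[R]_3 :=
  \row_i (if i == 0 then v 0 0 else if i == 1 then v 0 1 else 0).

Definition rot90 (v : 'rV[R]_2) : 'rV[R]_2 :=
  \row_j (if j == 0 then - v 0 1 else v 0 0).

Lemma dot2E (u v : 'rV[R]_2) : dot u v = u 0 0 * v 0 0 + u 0 1 * v 0 1.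
Proof. by rewrite dotE big_ord_recl big_ord1 lift_ord01. Qed.

Lemma dot_horizontal p v : dot p (horizontal v) = dot (hproj p) v.
Proof.
rewrite dot2E dotE !big_ord_recl big_ord0 !mxE /= addr0 mulr0 addr0.
by congr (p _ _ * _ + p _ _ * _); exact/val_inj.
Qed.

Lemma hproj_horizontal v : hproj (horizontal v) = v.
Proof. by apply/rowP; elim/ord2P; rewrite !mxE. Qed.

Lemma x3_horizontal v : x3 (horizontal v) = 0.
Proof. by rewrite /x3 mxE. Qed.

Lemma dot_rot90_rot90 v : dot (rot90 v) (rot90 v) = dot v v.
Proof. by rewrite !dot2E !mxE /=; ring. Qed.

Lemma dot_rot90 v : dot v (rot90 v) = 0.
Proof. by rewrite dot2E !mxE /=; ring. Qed.

Lemma dot_rot90_sum (v y : 'rV[R]_2) :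
  dot y v ^+ 2 + dot y (rot90 v) ^+ 2 = dot v v * dot y y.
Proof. by rewrite !dot2E !mxE /=; ring. Qed.

End Embedding.

(** * From a boundary point to a slab, and the conclusion *)

Lemma ereal_sup_ltyP (R : realType) (T : Type) (A : set T) (f : T -> R) :
  ereal_sup [set (f p)%:E | p in A] != +oo%E ->
  exists M, forall p, A p -> f p <= M.
Proof.
move=> supA.
have ub p : A p -> ((f p)%:E <= ereal_sup [set (f p)%:E | p in A])%E.
  by move=> Ap; apply: ereal_sup_ubound; exists p.
move: supA ub; case: (ereal_sup _) => [M _ ub|//|_ ub].
  by exists M => p /ub; rewrite lee_fin.
(* A supremum of [-oo] leaves [A] empty, so any bound serves. *)
by exists 0 => p /ub.
Qed.

Lemma eball_dot (R : realType) n (q y : 'rV[R]_n) rho : 0 < rho ->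
  dot (y - q) (y - q) < rho ^+ 2 -> eball q rho y.
Proof.
move=> rho0 yq; rewrite /eball /enorm /= -[ltRHS](ger0_norm (ltW rho0)).
by rewrite -sqrtr_sqr ltr_sqrt// exprn_gt0.
Qed.

Lemma dot_subC (R : realType) n (u v : 'rV[R]_n) :
  dot (u - v) (u - v) = dot (v - u) (v - u).
Proof. by rewrite -opprB dotNl dotC dotNl opprK. Qed.

Lemma boundary_escape (R : realType) n (K : set 'rV[R]_n) q s :
  closed K -> boundary K q -> 0 < s ->
  K q /\ exists2 z, ~ K z & dot (z - q) (z - q) < s.
Proof.
move=> clK [Kq nKq] s0; split; first exact: clK.
apply: contrapT => noz; apply: nKq.
have : \forall y \near q, dot (y - q) (y - q) < s.
  have := @continuous_sqdist _ _ q q; rewrite /continuous_at.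
  have -> : dot (q - q) (q - q) = 0 by apply/eqP; rewrite dot_eq0 subrr.
  by move/cvgr_lt; apply.
by apply: filterS => y ys; apply: contrapT => nKy; apply: noz; exists y.
Qed.

Theorem theorem10 (R : realType) (S : smooth_surface R) (F : S -> 'rV[R]_3)
    (F_translater : translater F) (F_proper : properly_immersed F)
    (bd_neq0 : boundary (closed_convex_hull (@hproj R @` range F)) !=set0) :
  forall q : 'rV[R]_2,
    boundary (closed_convex_hull (@hproj R @` range F)) q ->
  forall rho : R, 0 < rho ->
    ereal_sup [set (x3 p)%:E | p in range F `&` @hproj R @^-1` eball q rho]
    = +oo%E.
Proof.
move=> q bq rho rho0; apply/eqP; apply: contrapT => /negP.
move=> /(@ereal_sup_ltyP _ _ _ (@x3 R))[M HM].
set K := closed_convex_hull _ in bq.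
have clK : closed K by exact: closed_convex_hull_closed.
have cK : @convex_set R 'rV[R]_2 K by exact: closed_convex_hull_convex.
have FK p : K (hproj (F p)).
  by apply: closed_convex_hull_sub; exists (F p) => //; exists p.
(* [z] is within [s] of [q], [q'] within [s] of [z], and the points [y] considered below satisfy
   [|y - q'|^2 <= s^2 / 2]. Two uses of [dot_add_le] give [|y - q|^2 <= 9 s^2 < rho^2]. *)
pose s := rho / 4; have s0 : 0 < s by rewrite divr_gt0.
have [Kq [z Kz zq]] := boundary_escape clK bq (exprn_gt0 2 s0).
(* Projecting an outside point [z] onto the hull yields a supporting line at [q'], with outward
   normal [z - q']. *)
have [q' Kq' q'min] := exists_nearest_point z clK (ex_intro _ q Kq).
have q'z := q'min q Kq.
have supp := nearest_point_supporting cK Kq' q'min.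
have zq'0 : 0 < dot (z - q') (z - q').
  by rewrite dot_gt0 subr_eq0; apply/eqP => zq'; apply: Kz; rewrite zq'.
pose l := enorm (z - q'); have l0 : 0 < l by rewrite sqrtr_gt0.
pose n := l^-1 *: (z - q').
have nn : dot n n = 1.
  by rewrite dotZl dotZr -enorm_sqr -/l expr2 mulKf ?mulVf// gt_eqF.
pose w1 := horizontal n; pose w2 := horizontal (rot90 n).
have hor v : dot (horizontal v) (e3 R) = 0 by rewrite dot_e3 x3_horizontal.
have Fle p : dot (hproj (F p)) n <= dot q' n.
  rewrite -subr_le0 -dotBl dotZr pmulr_rle0 ?invr_gt0//; exact: supp.
have gap := @translater_slab_gap R S F w1 w2 _ _ _ (hor _) (hor _)
  (dot q' n) (dot q' (rot90 n)) (s / 2) (s / 2) M F_translater F_proper.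
have {gap}Fgap p : dot (hproj (F p)) n <= dot q' n - s / 2.
  rewrite -dot_horizontal; apply: gap => //.
  - by rewrite dot_horizontal hproj_horizontal.
  - by rewrite dot_horizontal hproj_horizontal dot_rot90_rot90.
  - by rewrite dot_horizontal hproj_horizontal dot_rot90.
  - by rewrite divr_gt0.
  - by rewrite divr_gt0.
  - by move=> p'; rewrite dot_horizontal.
  move=> p'; rewrite !dot_horizontal => near1 near2; rewrite dot_e3; apply: HM.
  split; first by exists p'.
  apply: eball_dot => //; set y := hproj (F p') in near1 near2 *.
  have far1 := Fle p'; rewrite -/y in far1.
  have yq' : dot (y - q') (y - q') <= 2 * (s / 2) ^+ 2.
    have := dot_rot90_sum n (y - q'); rewrite nn mul1r => <-.
    rewrite !dotBl mulr_natl mulr2n lerD//.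
      by apply: sqr_le_bound; lra.
    by apply: sqr_le_bound; rewrite -ler_norml ltW.
  have -> : y - q = (y - q') + ((q' - z) + (z - q)) by rewrite !addrA !subrK.
  have := dot_add_le (y - q') ((q' - z) + (z - q)).
  have := dot_add_le (q' - z) (z - q).
  rewrite (dot_subC q z) in q'z.
  have -> : rho = 4 * s by rewrite /s; field.
  have := exprn_gt0 2 s0; lra.
(* The hull lies in the smaller half-plane, which does not contain [q']. *)
have := @closed_convex_hull_min _ _ (@hproj R @` range F) _
  (@closed_halfspace _ _ n (dot q' n - s / 2))
  (@convex_halfspace _ _ n (dot q' n - s / 2)).
have Fhalf : @hproj R @` range F `<=` [set y | dot y n <= dot q' n - s / 2].
  by move=> _ [_ [p _ <-] <-]; exact: Fgap.
by move=> /(_ Fhalf q' Kq') /= q'lt; lra.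
Qed.
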